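(* Let $\mathcal{T}$ be one of the regular tilings $(4^4)$, $(6^3)$, $(3^6)$ of $\mathbb{C}$ (positioned as in the context), let $\Lambda$ be the orbit of the origin under the action of the translation group $\mathrm{T}(\mathcal{T})$, let $\alpha\in\mathbb{C}\setminus\{0\}$, and let $\varphi_\alpha(z)=\exp(2\pi i z/\alpha)$. If $\alpha\in\Lambda$ and $|\alpha|>\max\{|z_1-z_2| : z_1,z_2\in\partial T,\ T\in\mathcal{T}\}$ (where $\partial T$ denotes the boundary of the tile $T$), then $\mathcal{S}_\alpha=\{\varphi_\alpha(T) : T\in\mathcal{T}\}$ is a tiling of $\mathbb{C}^{*}$.
   Context: The plane $\mathbb{R}^2$ is identified with $\mathbb{C}$, $\mathbb{C}^*=\mathbb{C}\setminus\{0\}$, $i=\sqrt{-1}$, $\omega=e^{2\pi i/3}$. A tile is a bounded (hence compact) set that is the closure of its interior. A tiling of $Y$ ($Y=\mathbb{C}$ or $\mathbb{C}^*$) is a countable set of tiles contained in $Y$ whose union is $Y$ and such that any two distinct tiles in the set have disjoint interiors. The regular tilings are positioned as follows. $(4^4)$: the regular tiling by unit squares whose set of centers is $\mathbb{Z}[i]$; here $\Lambda=\mathbb{Z}[i]$. $(6^3)$: the regular tiling by regular hexagons whose set of centers is $\mathbb{Z}[\omega]$; here $\Lambda=\mathbb{Z}[\omega]$. $(3^6)$: the regular tiling by equilateral triangles whose set of vertices is the ideal $P_0=(2+\omega)$ of $\mathbb{Z}[\omega]$ (so the side length is $\sqrt3$); here $\Lambda=P_0$. The translation group $\mathrm{T}(\mathcal{T})$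 is the group of all translations of $\mathbb{C}$ mapping the set of tiles $\mathcal{T}$ to itself. The map $\varphi_\alpha$ is regarded as a map $\mathbb{C}\to\mathbb{C}^*$. *)

(* Defs.v *)
(* The plane is [R[i]], for an arbitrary [R : realType]. *)
From HB Require Import structures.
From mathcomp Require Import all_boot all_order all_algebra.
From mathcomp Require Import all_classical all_reals all_analysis.
From mathcomp Require Import complex.
Import numFieldNormedType.Exports.

Set Implicit Arguments.
Unset Strict Implicit.
Unset Printing Implicit Defensive.

Import Order.TTheory GRing.Theory Num.Theory.

Local Open Scope classical_set_scope.
Local Open Scope ring_scope.

(* The library provides no topology on [R[i]] itself; we transfer the one of
   [R[i]] seen as a normed module over itself, i.e. the metric topology of the
   modulus, so that [closure], [interior], [bounded_set], ... apply to
   [set R[i]]. *)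
HB.instance Definition _ (R : realType) := NormedModule.copy R[i] R[i]^o.

Section Definitions.
Variable R : realType.
Local Notation C := R[i].
Implicit Types (T Y : set C) (S : set (set C)).

Definition tile T := bounded_set T /\ T = closure T°.

(* Tiles are closures of interiors in the plane, whatever [Y] is. In
   [trivIset], indices whose interiors meet are equal, i.e. distinct tiles
   have disjoint interiors. *)
Definition tiling Y S :=
  [/\ countable S,
      forall T, S T -> tile T /\ T `<=` Y,
      \bigcup_(T in S) T = Y
    & trivIset S (fun T => T°)].

Definition boundary T : set C := closure T `\` T°.

Definition punctured_plane : set C := [set z | z != 0].

Definition Cexp (z : C) : C :=
  let: (x +i* y)%C := z in (expR x)%:C%C * (cos y +i* sin y)%C.

Definition two_pi_i : C := (pi *+ 2)%:C%C * 'i%C.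

Definition varphi (alpha z : C) : C := Cexp (two_pi_i * z / alpha).

Definition omega : C := Cexp (two_pi_i / 3).

(* Z + Z theta; this is the ring Z[theta] for theta = i and theta = omega. *)
Definition Zadjoin (theta : C) : set C :=
  [set z | exists a b : int, z = a%:~R + b%:~R * theta].

Definition P0 : set C := [set (2 + omega) * z | z in Zadjoin omega].

Definition convex_hull n (v : 'I_n -> C) : set C :=
  [set z | exists t : 'I_n -> R,
     [/\ forall k, 0 <= t k, \sum_k t k = 1
       & z = \sum_k (t k)%:C%C * v k]].

(* Regular n-gon with center c, one of whose vertices is c + r. *)
Definition regular_polygon (n : nat) (c r : C) : set C :=
  convex_hull (fun k : 'I_n => c + r * Cexp (two_pi_i * k%:R / n%:R)).

(* Edge-to-edge unit squares centered at Z[i] must have vertices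
   c + (+-1 +- i) / 2. *)
Definition square_tiling : set (set C) :=
  [set regular_polygon 4 c ((1 + 'i%C) / 2) | c in Zadjoin 'i%C].

(* (2 + omega) / 3 = exp (i pi / 6) / sqrt 3 is the barycenter of the adjacent
   centers 0, 1 and 1 + omega, hence a common vertex of their hexagons. *)
Definition hexagonal_tiling : set (set C) :=
  [set regular_polygon 6 c ((2 + omega) / 3) | c in Zadjoin omega].

(* sqrt 3 is the minimal distance between points of P0, so the triangles of
   side sqrt 3 with vertices in P0 are exactly the tiles. *)
Definition triangular_tiling : set (set C) :=
  [set T | exists v : 'I_3 -> C,
     [/\ forall k, P0 (v k),
         forall j k, j != k -> `|v j - v k| = (Num.sqrt 3)%:C%C
       & T = convex_hull v]].

Definition translation (v : C) : C -> C := fun z => z + v.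

Definition translation_group S : set (C -> C) :=
  [set f | (exists v, f = translation v) /\ [set f @` T | T in S] = S].

Definition orbit_of_origin S : set C := [set f 0 | f in translation_group S].

(* Moduli are elements of [R[i]], compared by its order, which extends that of
   R and in which comparable elements have the same imaginary part. *)
Definition boundary_distances S : set C :=
  [set d | exists T z1 z2,
     [/\ S T, boundary T z1, boundary T z2 & d = `|z1 - z2|]].

Definition is_max (A : set C) (m : C) := A m /\ ubound A m.

End Definitions.

Arguments omega {R}.
Arguments P0 {R}.
Arguments punctured_plane {R}.
Arguments two_pi_i {R}.
Arguments square_tiling {R}.
Arguments hexagonal_tiling {R}.
Arguments triangular_tiling {R}.

(* Main.v *)
(** The function [varphi alpha] is continuous and open, maps onto the punctured
    plane, and identifies exactly the points that differ by an integer multiple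
    of [alpha]. Hence the image of a tile is compact and is the closure of its
    interior. If the interiors of [varphi alpha @` T1] and [varphi alpha @` T2]
    meet, then, interiors of tiles being dense in them, so do those of
    [T1 + n alpha] and [T2] for some integer [n]; as [T1 + n alpha] is again a
    tile, it is [T2], and the two images coincide. It remains to see that the
    three sets of regular polygons are tilings, for which each polygon is
    written as an intersection of half planes in coordinates adapted to the
    lattice; the tile containing a point is found by rounding these
    coordinates. *)
Require Import Defs.
From mathcomp Require Import all_boot all_order all_algebra.
From mathcomp Require Import all_classical all_reals all_analysis.
From mathcomp Require Import complex.
From mathcomp Require Import ring lra zify.
Import numFieldNormedType.Exports.
Import Order.TTheory GRing.Theory Num.Theory.
Local Open Scope classical_set_scope.
Local Open Scope ring_scope.

Set Implicit Arguments.
Unset Strict Implicit.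
Unset Printing Implicit Defensive.

Local Notation Re := (@complex.Re _).
Local Notation Im := (@complex.Im _).

(** * Topology of the complex plane through real and imaginary parts *)

Section ComplexTopology.
Variable R : realType.
Local Notation C := R[i].

Lemma ReB (z w : C) : Re (z - w) = Re z - Re w.
Proof. by case: z w => ? ? [? ?]. Qed.

Lemma ImB (z w : C) : Im (z - w) = Im z - Im w.
Proof. by case: z w => ? ? [? ?]. Qed.

Lemma ler_Re_norm (z : C) : `|Re z| <= Re `|z|.
Proof. by have := normc_ge_Re z; rewrite lecE => /andP[]. Qed.

Lemma ler_Im_norm (z : C) : `|Im z| <= Re `|z|.
Proof. by rewrite normc_def/= -sqrtr_sqr ler_wsqrtr// lerDr sqr_ge0. Qed.

Lemma ler_norm_ReIm (a b : R) : `|(a +i* b)%C| <= (`|a| + `|b|)%:C%C.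
Proof.
rewrite normc_def/= lecR -[leRHS]ger0_norm ?addr_ge0// -sqrtr_sqr.
apply: ler_wsqrtr; rewrite sqrrD !real_normK ?num_real//.
by have := mulr_ge0 (normr_ge0 a) (normr_ge0 b); lra.
Qed.

Lemma near_dist_complex (z : C) (e : R) : 0 < e ->
  \forall w \near z, `|z - w| < e%:C%C.
Proof. by move=> e0; apply/nbhs_normP; exists e%:C%C => //=; rewrite ltcR. Qed.

Lemma continuous_Re : continuous (Re : C -> R).
Proof.
move=> z; apply/(@cvgrPdist_lt _ _ _ (nbhs z)) => e e0.
near=> w.
have : `|z - w| < e%:C%C by near: w; exact: near_dist_complex.
rewrite ltcE => /andP[_ /=]; apply: le_lt_trans.
by rewrite -ReB; exact: ler_Re_norm.
Unshelve. all: by end_near. Qed.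

Lemma continuous_Im : continuous (Im : C -> R).
Proof.
move=> z; apply/(@cvgrPdist_lt _ _ _ (nbhs z)) => e e0.
near=> w.
have : `|z - w| < e%:C%C by near: w; exact: near_dist_complex.
rewrite ltcE => /andP[_ /=]; apply: le_lt_trans.
by rewrite -ImB; exact: ler_Im_norm.
Unshelve. all: by end_near. Qed.

Lemma cvg_complex (T : Type) (F : set_system T) (FF : Filter F) (f g : T -> R)
    (a b : R) : f @ F --> a -> g @ F --> b ->
  ((fun t => (f t +i* g t)%C : C) @ F) --> ((a +i* b)%C : C).
Proof.
move=> fa gb; apply/cvgrPdist_lt => -[e e'].
(* A positive element of [R[i]] is real, so the radius may be taken in [R]. *)
rewrite ltcE/= => /andP[/eqP -> e0].
have e20 : 0 < e / 2 by rewrite divr_gt0.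
move/cvgrPdist_lt : fa => /(_ _ e20) fa.
move/cvgrPdist_lt : gb => /(_ _ e20) gb.
near=> t.
apply: le_lt_trans (ler_norm_ReIm _ _) _.
rewrite ltcR [ltRHS]splitr ltrD//=; near: t; [exact: fa|exact: gb].
Unshelve. all: by end_near. Qed.

Lemma continuous_complex (T : topologicalType) (f : T -> C) :
  continuous (Re \o f) -> continuous (Im \o f) -> continuous f.
Proof.
move=> cr ci x.
have -> : f = fun t => (Re (f t) +i* Im (f t))%C.
  by apply/funext => t; case: (f t).
exact: cvg_complex (cr x) (ci x).
Qed.

Lemma continuous_ReIm_linear (p q : R) :
  continuous (fun z : C => p * Re z + q * Im z).
Proof.
move=> z; exact: (@cvgD _ _ _ (nbhs z) _ _ _ _ _
  (cvgM (cvg_cst _) (@continuous_Re z)) (cvgM (cvg_cst _) (@continuous_Im z))).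
Qed.

Lemma continuous_complexM (c : C) : continuous (fun z : C => c * z).
Proof.
apply: continuous_complex.
- have -> : Re \o (fun z : C => c * z) = fun z => Re c * Re z + - Im c * Im z.
    by apply/funext => -[? ?]; case: c => ? ? /=; rewrite mulNr.
  exact: continuous_ReIm_linear.
- have -> : Im \o (fun z : C => c * z) = fun z => Im c * Re z + Re c * Im z.
    by apply/funext => -[? ?]; case: c => ? ? /=; rewrite addrC.
  exact: continuous_ReIm_linear.
Qed.

Lemma bounded_set_complexP (A : set C) :
  (exists M : R, forall z, A z -> `|Re z| <= M /\ `|Im z| <= M) <->
  bounded_set A.
Proof.
split=> [[M AM]|].
  exists (M + M)%:C%C; split; first by rewrite complex_real.
  move=> N MN z /= Az; apply/ltW; apply: le_lt_trans MN.
  case: z Az => a b /AM[/= aM bM].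
  by apply: le_trans (ler_norm_ReIm _ _) _; rewrite lecR lerD.
(* [bounded_set] only gives bounds by numbers strictly above [M], hence the [+ 1]; as [M] is real,
   [Re M] stands for it. *)
case=> M [Mreal AM]; exists (Re M + 1) => z Az.
have /AM/(_ _ Az) : M < (Re M + 1)%:C%C.
  by move/complex_realP : Mreal => [k ->]; rewrite ltcR/= ltrDl.
rewrite /= lecE => /andP[_ /= zM].
by split; apply: le_trans zM; [exact: ler_Re_norm|exact: ler_Im_norm].
Qed.

End ComplexTopology.

(** * The complex exponential: kernel, continuity, surjectivity, openness *)

Section ComplexExponential.
Variable R : realType.
Local Notation C := R[i].

Lemma CexpE (x y : R) :
  Cexp (x +i* y)%C = (expR x * cos y +i* (expR x * sin y))%C.
Proof. by rewrite /Cexp; simpc. Qed.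

Lemma CexpD (z w : C) : Cexp (z + w) = Cexp z * Cexp w.
Proof.
case: z w => a b [c d].
rewrite [LHS](CexpE (a + c) (b + d)) !CexpE expRD cosD sinD.
by simpc; congr (_ +i* _)%C; ring.
Qed.

Lemma Cexp0 : Cexp 0 = 1 :> C.
Proof. by rewrite (CexpE 0 0) expR0 cos0 sin0 mul1r mulr0. Qed.

Lemma Cexp_neq0 (z : C) : Cexp z != 0.
Proof.
apply/eqP => z0; have : Cexp (z - z) = 0 by rewrite CexpD z0 mul0r.
by rewrite subrr Cexp0 => /eqP; rewrite oner_eq0.
Qed.

Lemma CexpN (z : C) : Cexp (- z) = (Cexp z)^-1.
Proof.
by apply: (mulfI (Cexp_neq0 z)); rewrite -CexpD subrr Cexp0 divff ?Cexp_neq0.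
Qed.

Lemma CexpMn (z : C) n : Cexp (z *+ n) = Cexp z ^+ n.
Proof.
elim: n => [|n IH]; first by rewrite mulr0n Cexp0.
by rewrite mulrS exprS CexpD IH.
Qed.

Lemma two_pi_iE : two_pi_i = (0 +i* (pi *+ 2))%C :> C.
Proof. by rewrite /two_pi_i; simpc. Qed.

Lemma Cexp_two_pi_i : Cexp two_pi_i = 1 :> C.
Proof.
by rewrite two_pi_iE CexpE expR0 cos2pi sin2pi mul1r mulr0.
Qed.

Lemma Cexp_two_pi_iMz (n : int) : Cexp (two_pi_i *~ n) = 1 :> C.
Proof.
case: n => n; first by rewrite -pmulrn CexpMn Cexp_two_pi_i expr1n.
by rewrite NegzE mulrNz CexpN -pmulrn CexpMn Cexp_two_pi_i expr1n invr1.
Qed.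

(** Subtracting a multiple of [two_pi_i] brings the imaginary part to some [t] in [[0, 2 pi)]. Then
    the modulus forces the real part to be 0, and [cos t = 1] forces [t = 0]. *)
Lemma Cexp_eq1 (z : C) : Cexp z = 1 -> exists n : int, z = two_pi_i *~ n.
Proof.
have pi0 := pi_gt0 R.
case: z => x y; set n := Num.floor (y / (pi *+ 2)).
have nE : (two_pi_i *~ n : C) = (0 +i* (pi *+ 2 * n%:~R))%C.
  rewrite -mulrzr two_pi_iE -(rmorph_int (real_complex R)) /real_complex_def.
  by simpc.
move=> xy1; exists n.
have : Cexp ((x +i* y)%C - two_pi_i *~ n) = 1.
  by rewrite CexpD xy1 CexpN Cexp_two_pi_iMz invr1 mulr1.
rewrite nE; set t := y - (pi *+ 2 * n%:~R).
have -> : ((x +i* y)%C - (0 +i* (pi *+ 2 * n%:~R))%C : C) = (x +i* t)%C.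
  by simpc.
have pi20 : 0 < pi *+ 2 :> R by rewrite mulrn_wgt0.
have t0 : 0 <= t.
  by rewrite subr_ge0 mulrC -ler_pdivlMr// Num.Theory.floor_le.
have t2pi : t < pi *+ 2.
  rewrite ltrBlDr -[X in X + _]mulr1 -mulrDr mulrC -ltr_pdivrMr//.
  by rewrite addrC -intrD1 Num.Theory.lt_succ_floor.
rewrite CexpE => -[ec es].
have e1 : expR x = 1.
  apply/eqP; rewrite -(@eqrXn2 _ 2) ?expR_ge0// expr1n.
  have -> : expR x ^+ 2 = (expR x * cos t) ^+ 2 + (expR x * sin t) ^+ 2.
    by rewrite !exprMn -mulrDr cos2Dsin2 mulr1.
  by rewrite ec es expr1n expr0n addr0.
have x0 : x = 0 by apply: expR_inj; rewrite expR0.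
have cost : cos t = 1 by rewrite -ec e1 mul1r.
suff : t = 0 by rewrite /t x0 => /subr0_eq <-.
have [tpi|tpi] := leP t pi.
  by apply: cos_inj; rewrite ?in_itv/= ?lexx ?t0 ?tpi ?pi_ge0 ?cost ?cos0.
(* For [t > pi] the reflection [2 pi - t] lies in [[0, pi]], where [cos] is injective; it would be
   0, against [t < 2 pi]. *)
have cost' : cos (- t + pi *+ 2) = 1 by rewrite cosD2pi cosN.
have : - t + pi *+ 2 = 0.
  apply: cos_inj; rewrite ?in_itv/= ?lexx ?pi_ge0 ?cost' ?cos0//.
  by rewrite mulr2n in t2pi *; lra.
by move: t2pi => /[swap] /eqP; rewrite addrC subr_eq0 => /eqP ->; rewrite ltxx.
Qed.

Lemma continuous_Cexp : continuous (@Cexp R).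
Proof.
have cc (h : R -> R) : continuous h ->
    continuous (fun z : C => expR (Re z) * h (Im z)).
  move=> ch z; apply: (@cvgM _ _ (nbhs z)).
    exact: (@continuous_comp _ _ _ Re expR z
      (@continuous_Re R z) (@continuous_expR R _)).
  exact: (@continuous_comp _ _ _ Im h z (@continuous_Im R z) (ch _)).
apply: continuous_complex.
- have -> : Re \o @Cexp R = fun z => expR (Re z) * cos (Im z).
    by apply/funext => -[a b] /=; simpc.
  exact/cc/continuous_cos.
- have -> : Im \o @Cexp R = fun z => expR (Re z) * sin (Im z).
    by apply/funext => -[a b] /=; simpc.
  exact/cc/continuous_sin.
Qed.

(* The principal branch on the half plane [0 < Re z]. *)
Definition half_plane_log (z : C) : C :=
  (ln (Re z * Num.sqrt (1 + (Im z / Re z) ^+ 2)) +i* atan (Im z / Re z))%C.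

(** With [t = b / a], [cos (atan t)] is [1 / sqrt (1 + t ^ 2)] and [sin (atan t)] is [t] times that,
    so the modulus [a * sqrt (1 + t ^ 2)] restores [a] and [b]. *)
Lemma half_plane_logK (z : C) : 0 < Re z -> Cexp (half_plane_log z) = z.
Proof.
case: z => a b; rewrite [Re _]/= => a0; rewrite /half_plane_log CexpE/=.
set t := b / a; have t0 : 0 < 1 + t ^+ 2 by rewrite ltr_pwDl ?sqr_ge0.
have s0 : 0 < Num.sqrt (1 + t ^+ 2) by rewrite sqrtr_gt0.
have c0 : cos (atan t) != 0 by rewrite cos_atan invr_neq0 ?gt_eqF.
have -> : sin (atan t) = t * cos (atan t).
  by rewrite -[X in X * _]atanK /tan divfK.
rewrite lnK ?posrE ?mulr_gt0// cos_atan; congr (_ +i* _)%C.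
  by rewrite mulfK ?gt_eqF.
by rewrite mulrCA mulfK ?gt_eqF// /t divfK ?gt_eqF.
Qed.

Lemma half_plane_log1 : half_plane_log 1 = 0.
Proof.
by rewrite /half_plane_log/= mul0r expr0n addr0 sqrtr1 mulr1 ln1 atan0.
Qed.

(** For [nbhs_Cexp], which divides by [Cexp z] and so evaluates the logarithm near 1. *)
Lemma cvg_half_plane_log1 : half_plane_log z @[z --> (1 : C)] --> (0 : C).
Proof.
have r1 : Re z @[z --> (1 : C)] --> (1 : R) := @continuous_Re R 1.
have i0 : Im z @[z --> (1 : C)] --> (0 : R) := @continuous_Im R 1.
have t0 : Im z / Re z @[z --> (1 : C)] --> (0 : R).
  by rewrite -[0](mul0r 1^-1); exact: (cvgM i0 (cvgV (oner_neq0 R) r1)).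
have s1 : Num.sqrt (1 + (Im z / Re z) ^+ 2) @[z --> (1 : C)] --> (1 : R).
  rewrite -[X in _ --> X]sqrtr1.
  apply: (@continuous_cvg _ _ _ (nbhs (1 : C)) _ _ Num.sqrt).
    exact: sqrt_continuous.
  rewrite -[X in _ --> X]addr0 -[X in _ + X](mul0r 0).
  exact: (@cvgD _ _ _ (nbhs (1 : C)) _ _ _ _ _ (cvg_cst _) (cvgM t0 t0)).
rewrite -half_plane_log1.
apply: (@cvg_complex _ _ (nbhs (1 : C))).
- apply: (@continuous_cvg _ _ _ (nbhs (1 : C)) _ _ (@ln R)).
    by apply: continuous_ln; rewrite /= mul0r expr0n addr0 sqrtr1 mulr1.
  rewrite /= mul0r expr0n addr0 sqrtr1.
  exact: (cvgM r1 s1).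
- rewrite /= mul0r.
  apply: (@continuous_cvg _ _ _ (nbhs (1 : C)) _ _ (@atan R)) => //.
  exact: continuous_atan.
Qed.

(** Quarter turns, that is factors ['i = Cexp (i pi / 2)], carry every nonzero number into the right
    half plane, where [half_plane_log] is a logarithm. *)
Lemma Cexp_surj (w : C) : w != 0 -> exists z, Cexp z = w.
Proof.
have pos (v : C) : 0 < Re v -> exists z, Cexp z = v.
  by move=> v0; exists (half_plane_log v); rewrite half_plane_logK.
have iE : Cexp (0 +i* (pi / 2))%C = 'i%C :> C.
  by rewrite CexpE expR0 cos_pihalf sin_pihalf mulr0 mul1r.
have rot (v : C) : (exists z, Cexp z = 'i%C * v) -> exists z, Cexp z = v.
  case=> z zv; exists (- (0 +i* (pi / 2))%C + z).
  by rewrite CexpD zv CexpN iE mulrA mulVf ?mul1r// -iE Cexp_neq0.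
case: w => a b ab0.
have [a0|a0|a0] := ltgtP a 0.
- by apply/rot/rot/pos; simpc; rewrite oppr_gt0.
- exact: pos.
have [b0|b0|b0] := ltgtP b 0.
- by apply/rot/pos; simpc; rewrite oppr_gt0.
- by apply/rot/rot/rot/pos; simpc.
by move: ab0; rewrite a0 b0 eqxx.
Qed.

(** This makes [Cexp] an open map: [g w = z + log (w / Cexp z)] tends to [z] as [w] tends to
    [Cexp z], and [Cexp (g w) = w] once [w / Cexp z] has positive real part. *)
Lemma nbhs_Cexp (z : C) (U : set C) : nbhs z U -> nbhs (Cexp z) (@Cexp R @` U).
Proof.
move=> zU.
pose g w := z + half_plane_log ((Cexp z)^-1 * w).
have gw1 : (Cexp z)^-1 * w @[w --> Cexp z] --> (1 : C).
  by rewrite -[1](mulVf (Cexp_neq0 z)); exact: continuous_complexM.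
have gz : g w @[w --> Cexp z] --> z.
  rewrite -[X in _ --> X]addr0.
  apply: (@cvgD _ _ _ (nbhs (Cexp z)) _ _ _ _ _ (cvg_cst _)).
  exact: cvg_comp gw1 cvg_half_plane_log1.
near=> w; exists (g w); first by near: w; exact: gz.
rewrite /g CexpD half_plane_logK ?mulrA ?divff ?Cexp_neq0 ?mul1r//.
near: w.
have : Re ((Cexp z)^-1 * w) @[w --> Cexp z] --> (1 : R).
  by apply: cvg_comp gw1 _; exact: (@continuous_Re R 1).
by move/(_ _ (lt_nbhsr ltr01)).
Unshelve. all: by end_near. Qed.

End ComplexExponential.

(** * Compact subsets of the plane *)

Section Compactness.
Variable R : realType.
Local Notation C := R[i].

(** Such a set is a closed part of the continuous image of a square with sides [[- M, M]]. *)
Lemma bounded_closed_compact_complex (A : set C) :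
  bounded_set A -> closed A -> compact A.
Proof.
move=> /bounded_set_complexP[M AM] cA.
pose e (p : R * R) : C := (p.1 +i* p.2)%C.
have ce : continuous e.
  by apply: continuous_complex => p; [exact: cvg_fst|exact: cvg_snd].
have cK : compact (e @` (`[- M, M] `*` `[- M, M])).
  apply: continuous_compact; first exact: continuous_subspaceT.
  by apply: compact_setX; exact: segment_compact.
apply: (subclosed_compact cA cK) => -[a b] /AM[/= aM bM].
by exists (a, b) => //; split; rewrite /= in_itv/= -ler_norml.
Qed.

Lemma compact_bounded_complex (A : set C) : compact A -> bounded_set A.
Proof.
move=> cA; apply/bounded_set_complexP.
have cb (f : C -> R) : continuous f -> exists M, forall z, A z -> `|f z| <= M.
  move=> cf; have : compact (f @` A).
    by apply: continuous_compact => //; exact: continuous_subspaceT.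
  move=> /compact_bounded[M [_ fM]]; exists (M + 1) => z Az.
  by apply: (fM (M + 1)); [rewrite ltrDl|exists z].
have [M1 AM1] := cb _ (@continuous_Re R).
have [M2 AM2] := cb _ (@continuous_Im R).
exists (Num.max M1 M2) => z Az; rewrite !le_max AM1//.
by rewrite AM2// orbT.
Qed.

End Compactness.

(** * The covering map from the plane to the punctured plane *)

Section Varphi.
Variables (R : realType) (alpha : R[i]).
Hypothesis alpha0 : alpha != 0.
Local Notation C := R[i].

Let two_pi_i_neq0 : two_pi_i != 0 :> C.
Proof.
rewrite two_pi_iE eq_complex/= negb_and orbC gt_eqF//.
by rewrite mulrn_wgt0// pi_gt0.
Qed.

Let two_pi_i_div_neq0 : two_pi_i / alpha != 0.
Proof. by rewrite mulf_neq0// invr_eq0. Qed.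

Lemma varphiE z : varphi alpha z = Cexp (two_pi_i / alpha * z).
Proof. by rewrite /varphi mulrAC. Qed.

Lemma continuous_varphi : continuous (varphi alpha).
Proof.
move=> z.
have -> : varphi alpha = @Cexp R \o (fun z => two_pi_i / alpha * z).
  by apply/funext => w; rewrite varphiE.
by apply: continuous_comp; [exact: continuous_complexM|exact: continuous_Cexp].
Qed.

(** Multiplication by [two_pi_i / alpha] has a continuous inverse, so openness carries over from
    [Cexp]. *)
Lemma nbhs_varphi (z : C) (U : set C) :
  nbhs z U -> nbhs (varphi alpha z) (varphi alpha @` U).
Proof.
move=> zU; rewrite varphiE; set c := two_pi_i / alpha.
have -> : varphi alpha @` U = @Cexp R @` ((fun z => c * z) @` U).
  by rewrite image_comp; apply: eq_imagel => w _; rewrite varphiE.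
apply: nbhs_Cexp.
have cz : c^-1 * w @[w --> c * z] --> z.
  rewrite -[X in _ --> X](mulKf two_pi_i_div_neq0).
  exact: continuous_complexM.
near=> w; exists (c^-1 * w); last by rewrite mulVKf.
by near: w; exact: cz.
Unshelve. all: by end_near. Qed.

Lemma varphi_surj (w : C) : w != 0 -> exists z, varphi alpha z = w.
Proof.
move=> /Cexp_surj[z zw]; exists ((two_pi_i / alpha)^-1 * z).
by rewrite varphiE mulVKf.
Qed.

Lemma varphi_neq0 (z : C) : varphi alpha z != 0.
Proof. exact: Cexp_neq0. Qed.

Lemma varphi_translation (z : C) (n : int) :
  varphi alpha (z + alpha *~ n) = varphi alpha z.
Proof.
by rewrite !varphiE mulrDr CexpD mulrzAr divfK// Cexp_two_pi_iMz mulr1.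
Qed.

Lemma varphi_eq (z w : C) : varphi alpha z = varphi alpha w ->
  exists n : int, z = w + alpha *~ n.
Proof.
rewrite !varphiE => zw.
have : Cexp (two_pi_i / alpha * (z - w)) = 1.
  by rewrite mulrBr CexpD CexpN zw divff// Cexp_neq0.
move=> /Cexp_eq1[n]; rewrite -mulrzr -mulrA => /(mulfI two_pi_i_neq0) E.
exists n; apply/eqP; rewrite addrC -subr_eq -(mulVKf alpha0 (z - w)) E.
by rewrite mulrzr.
Qed.

End Varphi.

(** * Image of a tiling invariant under translation by [alpha] *)

Section ImageTiling.
Variables (R : realType) (alpha : R[i]).
Hypothesis alpha0 : alpha != 0.
Local Notation C := R[i].

Lemma tile_closed (T : set C) : tile T -> closed T.
Proof. by case=> _ ->; exact: closed_closure. Qed.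

Lemma tile_varphi (T : set C) : tile T -> tile (varphi alpha @` T).
Proof.
move=> tT; have cT : compact (varphi alpha @` T).
  apply: continuous_compact; first exact/continuous_subspaceT/continuous_varphi.
  by apply: bounded_closed_compact_complex; [case: tT|exact: tile_closed].
split; first exact: compact_bounded_complex.
apply/seteqP; split; last first.
  have cl : closed (varphi alpha @` T).
    exact: compact_closed (@norm_hausdorff _ _) cT.
  rewrite [X in _ `<=` X](proj1 (closure_id _) cl).
  by apply: closure_subset; exact: interior_subset.
(* A neighbourhood [B] of [varphi alpha z] pulls back to a neighbourhood of [z], which meets the
   interior of [T]; by openness the point found there has its image in the interior of the image. *)
move=> _ [z Tz <-] B zB.
have : closure T° z by case: tT => _ <-.
move=> /(_ _ (@continuous_varphi R alpha _ _ zB))[w [Tw Bw]].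
by exists (varphi alpha w); split => //; exact: nbhs_varphi.
Qed.

Lemma image_translation_interior (T : set C) (v z : C) :
  T° z -> (translation v @` T)° (z + v).
Proof.
move=> Tz.
have cz : w - v @[w --> z + v] --> z.
  rewrite -[X in _ --> X](addrK v).
  exact: (@cvgB _ _ _ (nbhs (z + v)) _ _ _ _ _ cvg_id (cvg_cst _)).
near=> w; exists (w - v); last by rewrite /translation subrK.
by near: w; exact: (cz _ Tz).
Unshelve. all: by end_near. Qed.

Lemma tiling_varphi (S : set (set C)) : tiling setT S ->
  [set translation alpha @` T | T in S] = S ->
  tiling punctured_plane [set varphi alpha @` T | T in S].
Proof.
move=> [cS tS covS trivS] aS.
(* Invariance under [alpha] gives invariance under its integer multiples; for the negative ones,
   every tile of [S] is the translate by [alpha] of another tile of [S]. *)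
have translate_in (n : int) T : S T -> S (translation (alpha *~ n) @` T).
  have transD (u v : C) A :
      translation u @` (translation v @` A) = translation (v + u) @` A.
    rewrite image_comp; apply: eq_imagel => z _ /=.
    by rewrite /translation addrA.
  have trans0 A : translation (0 : C) @` A = A.
    by rewrite -[RHS]image_id; apply: eq_imagel => z _; exact: addr0.
  move=> ST; elim/int_ind: n => [|n IH|n IH]; first by rewrite mulr0z trans0.
    by rewrite intS mulrzDr mulr1z addrC -transD -aS;
      exists (translation (alpha *~ n) @` T).
  move: IH; rewrite -{1}aS => -[T' ST' T'E].
  suff <- : T' = translation (alpha *~ (- n.+1%:Z)) @` T by [].
  rewrite -[LHS]trans0 -(subrr alpha) -transD T'E transD.
  by congr (translation _ @` T); rewrite intS opprD mulrzDr mulrN1z addrC.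
have varphi_translate (n : int) T :
    varphi alpha @` (translation (alpha *~ n) @` T) = varphi alpha @` T.
  rewrite image_comp; apply: eq_imagel => z _ /=.
  by rewrite varphi_translation.
split.
- exact: sub_countable (card_image_le _ _) cS.
- move=> _ [T ST <-]; split; first by apply: tile_varphi; exact: (tS _ ST).1.
  by move=> _ [z _ <-]; exact: varphi_neq0.
- apply/seteqP; split => w.
    by move=> [_ [T ST <-] [z _ <-]]; exact: varphi_neq0.
  move=> /(varphi_surj alpha0)[z <-].
  have [T ST Tz] : (\bigcup_(T in S) T) z by rewrite covS.
  by exists (varphi alpha @` T); [exists T|exists z].
- move=> _ _ [T1 ST1 <-] [T2 ST2 <-] [w [w1 w2]].
  have dense (T : set C) (z : C) (A : set C) :
      S T -> T z -> nbhs (varphi alpha z) A ->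
      exists2 y, T° y & A (varphi alpha y).
    move=> ST Tz zA; have : closure T° z by case: (tS _ ST) => -[_ <-].
    by move=> /(_ _ (@continuous_varphi R alpha _ _ zA))[y []]; exists y.
  (* The preimages of [w] may lie on boundaries, so density is used twice: [y1] is interior to [T1]
     and its image lies in the image of [T2]; then [y2] is interior to [T2] and has the same image
     as some [x1] interior to [T1]. *)
  have [z1 Tz1 zw] := interior_subset w1; rewrite -zw in w1 w2.
  have [y1 Ty1 /interior_subset[z2 Tz2 zy]] :=
    dense _ _ _ ST1 Tz1 (nbhs_interior w2).
  have : nbhs (varphi alpha z2) (varphi alpha @` T1°).
    by rewrite zy; apply: nbhs_varphi => //; exact: nbhs_interior.
  move=> /(dense _ _ _ ST2 Tz2)[y2 Ty2 [x1 Tx1 xy]].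
  have [n y2E] := varphi_eq alpha0 (esym xy).
  rewrite -(varphi_translate n T1); congr (_ @` _).
  (* The point [y2 = x1 + n alpha] is interior both to [T1 + n alpha] and to [T2]. *)
  apply: trivS => //; first exact: translate_in.
  by exists y2; split=> //; rewrite y2E; exact: image_translation_interior.
Qed.

End ImageTiling.

(* A triple [(p, q, r)] stands for the half plane [p * x + q * y <= r]. *)
Definition sat (R : realType) (L : seq (R * R * R)) (x y : R) : bool :=
  all (fun l => l.1.1 * x + l.1.2 * y <= l.2) L.

Definition strict_sat (R : realType) (L : seq (R * R * R)) (x y : R) : bool :=
  all (fun l => l.1.1 * x + l.1.2 * y < l.2) L.

(** * Polygons as intersections of half planes in affine coordinates *)

Section Polygons.
Variables (R : realType) (g h : R[i]).
Local Notation C := R[i].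

Definition basis_det : R := Re g * Im h - Im g * Re h.

Hypothesis det0 : basis_det != 0.

(* Cramer's rule for [z = coord1 z * g + coord2 z * h]. *)
Definition coord1 (z : C) : R :=
  Im h / basis_det * Re z + - (Re h / basis_det) * Im z.
Definition coord2 (z : C) : R :=
  - (Im g / basis_det) * Re z + Re g / basis_det * Im z.
Definition lin_comb (x y : R) : C := x%:C%C * g + y%:C%C * h.

Lemma lin_combE (x y : R) :
  lin_comb x y = ((x * Re g + y * Re h) +i* (x * Im g + y * Im h))%C.
Proof. by rewrite /lin_comb; case: g h => ? ? [? ?]; simpc. Qed.

Lemma lin_combK1 (x y : R) : coord1 (lin_comb x y) = x.
Proof.
by rewrite lin_combE /coord1/=; move: det0; rewrite /basis_det => ?; field.
Qed.

Lemma lin_combK2 (x y : R) : coord2 (lin_comb x y) = y.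
Proof.
by rewrite lin_combE /coord2/=; move: det0; rewrite /basis_det => ?; field.
Qed.

Lemma lin_comb_coord (z : C) : lin_comb (coord1 z) (coord2 z) = z.
Proof.
case: z => a b; rewrite lin_combE /coord1 /coord2/=.
by move: det0; rewrite /basis_det => ?; congr (_ +i* _)%C; field.
Qed.

Lemma lin_comb_sum (I : finType) (t x y : I -> R) :
  \sum_k (t k)%:C%C * lin_comb (x k) (y k) =
  lin_comb (\sum_k t k * x k) (\sum_k t k * y k).
Proof.
rewrite /lin_comb !rmorph_sum/= !mulr_suml -big_split/=.
by apply: eq_bigr => k _; rewrite !rmorphM mulrDr !mulrA.
Qed.

Definition polygon (a b : R) (L : seq (R * R * R)) : set C :=
  [set z | sat L (coord1 z - a) (coord2 z - b)].

Definition open_polygon (a b : R) (L : seq (R * R * R)) : set C :=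
  [set z | strict_sat L (coord1 z - a) (coord2 z - b)].

Lemma continuous_coord_linear (p q a b : R) :
  continuous (fun z : C => p * (coord1 z - a) + q * (coord2 z - b)).
Proof.
have -> : (fun z : C => p * (coord1 z - a) + q * (coord2 z - b)) =
    (fun z => z + (- (p * a + q * b))) \o
    (fun z : C => (p * (Im h / basis_det) - q * (Im g / basis_det)) * Re z
     + (q * (Re g / basis_det) - p * (Re h / basis_det)) * Im z).
  by apply/funext => z; rewrite /comp /coord1 /coord2; ring.
move=> z; apply: continuous_comp; first exact: continuous_ReIm_linear.
exact: cvgD cvg_id (cvg_cst _).
Qed.

Lemma closed_polygon a b L : closed (polygon a b L).
Proof.
elim: L => [|l L IH].
  rewrite (_ : polygon _ _ _ = setT); first exact: closedT.
  by apply/seteqP; split.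
rewrite (_ : polygon _ _ _ =
    ((fun z => l.1.1 * (coord1 z - a) + l.1.2 * (coord2 z - b)) @^-1`
      [set x | x <= l.2]) `&` polygon a b L); last first.
  by apply/seteqP; split=> z /=; [move/andP|move=> [? ?]; apply/andP].
apply: closedI => //; apply: preimage_closed; last exact: closed_le.
by move=> z _; exact: continuous_coord_linear.
Qed.

Lemma open_open_polygon a b L : open (open_polygon a b L).
Proof.
elim: L => [|l L IH].
  rewrite (_ : open_polygon _ _ _ = setT); first exact: openT.
  by apply/seteqP; split.
rewrite (_ : open_polygon _ _ _ =
    ((fun z => l.1.1 * (coord1 z - a) + l.1.2 * (coord2 z - b)) @^-1`
      [set x | x < l.2]) `&` open_polygon a b L); last first.
  by apply/seteqP; split=> z /=; [move/andP|move=> [? ?]; apply/andP].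
apply: openI => //; apply: open_comp; last exact: open_lt.
by move=> z _; exact: continuous_coord_linear.
Qed.

Lemma open_polygonW a b L : open_polygon a b L `<=` polygon a b L.
Proof. by move=> z; apply: sub_all => l /ltW. Qed.

Lemma cvg_segment (z w : C) : (z + s%:C%C * w) @[s --> 0^'+] --> z.
Proof.
have cf : continuous (fun s : R => z + s%:C%C * w).
  have ca (p q : R) : continuous (fun s : R => p + s * q).
    move=> s; apply: cvgD; first exact: cvg_cst.
    by apply: cvgM; [exact: cvg_id|exact: cvg_cst].
  apply: continuous_complex.
  - rewrite (_ : _ \o _ = fun s : R => Re z + s * Re w); first exact: ca.
    by apply/funext => s; case: z w => ? ? [? ?] /=; simpc.
  - rewrite (_ : _ \o _ = fun s : R => Im z + s * Im w); first exact: ca.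
    by apply/funext => s; case: z w => ? ? [? ?] /=; simpc.
have := cf 0; rewrite /continuous_at mul0r addr0; exact: cvg_at_right_filter.
Qed.

(** An interior point can be moved a little by [(p, q)] within the polygon. This raises [p x + q y]
    by [s (p ^ 2 + q ^ 2) > 0], so the inequality was strict before the move. *)
Lemma interior_polygon a b L : all (fun l => l.1 != (0, 0)) L ->
  (polygon a b L)° `<=` open_polygon a b L.
Proof.
move=> L0 z zL; apply/allP => -[[p q] r] lL/=.
have pq0 : 0 < p ^+ 2 + q ^+ 2.
  have := allP L0 _ lL; rewrite /= xpair_eqE negb_and => pq.
  rewrite lt_def addr_ge0 ?sqr_ge0// andbT paddr_eq0 ?sqr_ge0// !sqrf_eq0.
  by rewrite negb_and.
(* [p g + q h] points out of the half plane. *)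
have [s [/allP/(_ _ lL)/= + s0]] :
    exists s, polygon a b L (z + s%:C%C * lin_comb p q) /\ 0 < s.
  near (0 : R)^'+ => s; exists s; split=> //.
  by near: s; exact: (@cvg_segment z (lin_comb p q) _ zL).
have -> : z + s%:C%C * lin_comb p q =
    lin_comb (coord1 z + s * p) (coord2 z + s * q).
  by rewrite -[X in X + _]lin_comb_coord /lin_comb !rmorphD !rmorphM/=; ring.
rewrite lin_combK1 lin_combK2.
by have := mulr_gt0 s0 pq0; lra.
Unshelve. all: by end_near. Qed.

(** By convexity, the segment from any point of the polygon to the strict solution [(x0, y0)] enters
    the open polygon at once, so the interior is dense. *)
Lemma tile_polygon a b L (x0 y0 M : R) :
  (forall x y, sat L x y -> `|x| <= M /\ `|y| <= M) -> strict_sat L x0 y0 ->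
  tile (polygon a b L).
Proof.
move=> LM L0; split.
  apply/bounded_set_complexP.
  (* Both coordinates are at most [M + |a| + |b|] in modulus; the second factor bounds their
     combinations in [Re z] and in [Im z] at once. *)
  exists ((M + `|a| + `|b|) * (`|Re g| + `|Re h| + `|Im g| + `|Im h|)).
  move=> z /LM[xM yM].
  have {}xM : `|coord1 z| <= M + `|a| + `|b|.
    have := ler_normB (coord1 z - a) (- a); rewrite normrN opprK subrK.
    by have := normr_ge0 b; lra.
  have {}yM : `|coord2 z| <= M + `|a| + `|b|.
    have := ler_normB (coord2 z - b) (- b); rewrite normrN opprK subrK.
    by have := normr_ge0 a; lra.
  have comb_le (p q : R) : `|coord1 z * p + coord2 z * q| <=
      (M + `|a| + `|b|) * (`|p| + `|q|).
    by rewrite mulrDr (le_trans (ler_normD _ _))// !normrM lerD// ler_wpM2r.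
  have N0 := le_trans (normr_ge0 _) xM.
  rewrite -[in `|Re z|](lin_comb_coord z) -[in `|Im z|](lin_comb_coord z).
  rewrite !lin_combE/=.
  split; apply: (le_trans (comb_le _ _)); apply: ler_wpM2l => //.
    by have := normr_ge0 (Im g); have := normr_ge0 (Im h); lra.
  by have := normr_ge0 (Re g); have := normr_ge0 (Re h); lra.
apply/seteqP; split; last first.
  rewrite [X in _ `<=` X](proj1 (closure_id _) (@closed_polygon a b L)).
  by by apply: closure_subset; exact: interior_subset.
move=> z zL B zB.
pose w := lin_comb (a + x0 - coord1 z) (b + y0 - coord2 z).
near (0 : R)^'+ => s.
exists (z + s%:C%C * w); split; last first.
  by near: s; exact: (@cvg_segment z w _ zB).
rewrite /interior; apply: filterS (@open_polygonW a b L) _.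
apply: open_nbhs_nbhs; split; first exact: open_open_polygon.
have -> : z + s%:C%C * w = lin_comb (coord1 z + s * (a + x0 - coord1 z))
    (coord2 z + s * (b + y0 - coord2 z)).
  by rewrite -[X in X + _]lin_comb_coord /w /lin_comb !rmorphD !rmorphM/=; ring.
apply/allP => -[[p q] r] lL; rewrite lin_combK1 lin_combK2/=.
have s0 : 0 < s by [].
have s1 : s < 1 by near: s; exact: nbhs_right_lt.
have /= h0 := allP L0 _ lL.
have /= h1 := allP zL _ lL.
set x := coord1 z in h1 *; set y := coord2 z in h1 *.
(* The slack at the moved point is [s] times the slack at [(x0, y0)] plus [1 - s] times the slack at
   [z]. *)
have : 0 < s * (r - (p * x0 + q * y0)) by rewrite mulr_gt0// subr_gt0.
have : 0 <= (1 - s) * (r - (p * (x - a) + q * (y - b))).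
  by rewrite mulr_ge0// subr_ge0// ltW.
lra.
Unshelve. all: by end_near. Qed.

End Polygons.

(** * Tilings by lattice translates of finitely or countably many polygons *)

Section LatticeTiling.
Variables (R : realType) (g h : R[i]).
Local Notation C := R[i].
Hypothesis det0 : basis_det g h != 0.
Local Notation polygon := (polygon g h).

(** [J] indexes the polygons attached to one lattice point: a single one for squares and hexagons,
    two for triangles. *)
Definition lattice_polygons (J : countType) (L : J -> seq (R * R * R)) :
    set (set C) :=
  range (fun i : int * int * J => polygon i.1.1%:~R i.1.2%:~R (L i.2)).

(** Reduces the tiling property to systems of linear inequalities in the coordinates. Disjointness
    may be checked on strict solutions, as [interior_polygon] puts interiors inside the open
    polygons. *)
Lemma tiling_lattice_polygons (J : countType) (L : J -> seq (R * R * R)) :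
  (forall j, all (fun l => l.1 != (0, 0)) (L j)) ->
  (forall j x y, sat (L j) x y -> `|x| <= 1 /\ `|y| <= 1) ->
  (forall j, exists x y, strict_sat (L j) x y) ->
  (forall x y : R, exists a b : int, exists j,
    sat (L j) (x - a%:~R) (y - b%:~R)) ->
  (forall (x y : R) (a b a' b' : int) j j',
    strict_sat (L j) (x - a%:~R) (y - b%:~R) ->
    strict_sat (L j') (x - a'%:~R) (y - b'%:~R) -> (a, b, j) = (a', b', j')) ->
  tiling setT (lattice_polygons L).
Proof.
move=> L0 Lbnd Lint Lcov Ldisj; split.
- exact: sub_countable (card_image_le _ _) (countableP _).
- move=> _ [[[a b] j] _ <-]; split=> //.
  have [x0 [y0 xy0]] := Lint j.
  exact: (tile_polygon det0 a%:~R b%:~R (Lbnd j) xy0).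
- apply/seteqP; split=> // z _.
  have [a [b [j zj]]] := Lcov (coord1 g h z) (coord2 g h z).
  by exists (polygon a%:~R b%:~R (L j)) => //; exists (a, b, j).
- move=> _ _ [[[a b] j] _ <-] [[[a' b'] j'] _ <-] [z [/= zj zj']].
  have := interior_polygon det0 (L0 j) zj.
  have := interior_polygon det0 (L0 j') zj'.
  by move=> /= zj1 /Ldisj/(_ zj1)[-> -> ->].
Qed.

(** Linear inequalities pass from the vertices to their convex combinations; conversely, the last
    hypothesis supplies barycentric weights, as a list so that they can be written out. *)
Lemma convex_hull_polygon n (v : 'I_n -> C) (vs : nat -> R * R) (a b : R) L :
  (forall k : 'I_n, v k = lin_comb g h (a + (vs k).1) (b + (vs k).2)) ->
  (forall k : 'I_n, sat L (vs k).1 (vs k).2) ->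
  (forall x y, sat L x y -> exists t : seq R,
    [/\ forall k : 'I_n, 0 <= t`_k, \sum_(k < n) t`_k = 1,
        x = \sum_(k < n) t`_k * (vs k).1
      & y = \sum_(k < n) t`_k * (vs k).2]) ->
  convex_hull v = polygon a b L.
Proof.
move=> vE vL Lv.
have shift (t : 'I_n -> R) (c : R) (f : 'I_n -> R) : \sum_k t k = 1 ->
    \sum_k t k * (c + f k) = c + \sum_k t k * f k.
  move=> t1; rewrite -[c in RHS]mul1r -t1 mulr_suml -big_split/=.
  by apply: eq_bigr => k _; rewrite mulrDr.
have vsum (t : 'I_n -> R) : \sum_k t k = 1 -> \sum_k (t k)%:C%C * v k =
    lin_comb g h (a + \sum_k t k * (vs k).1) (b + \sum_k t k * (vs k).2).
  move=> t1; rewrite -!shift// -lin_comb_sum.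
  by apply: eq_bigr => k _; rewrite vE.
apply/seteqP; split=> z.
  move=> [t [t0 t1 ->]]; rewrite vsum//.
  apply/allP => -[[p q] r] lL /=; rewrite lin_combK1// lin_combK2//.
  rewrite ![_ + \sum__ _]addrC !addrK !mulr_sumr -big_split/=.
  rewrite -[leRHS]mul1r -t1 mulr_suml; apply: ler_sum => k _.
  rewrite mulrCA [q * _]mulrCA -mulrDr ler_wpM2l//.
  exact: (allP (vL k) _ lL).
move=> /Lv[t [t0 t1 xE yE]]; exists (fun k => t`_k); split=> //.
by rewrite vsum// -xE -yE ![_ + (_ - _)]addrC !subrK lin_comb_coord.
Qed.

(** Successive vertices differ by a factor [zeta]. With [m] the action of [zeta] on coordinates,
    iterating [m] lists the vertices without trigonometry. *)
Lemma regular_polygon_lin_comb n (zeta : C) (m : R -> R -> R * R)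
    (x0 y0 a b : R) :
  Cexp (two_pi_i / n%:R) = zeta ->
  (forall x y,
    zeta * lin_comb g h x y = lin_comb g h (m x y).1 (m x y).2) ->
  regular_polygon n (lin_comb g h a b) (lin_comb g h x0 y0) =
  convex_hull (fun k : 'I_n =>
    let p := iter k (fun p => m p.1 p.2) (x0, y0) in
    lin_comb g h (a + p.1) (b + p.2)).
Proof.
move=> zE zm; rewrite /regular_polygon; congr convex_hull; apply/funext => k.
rewrite mulrAC mulr_natr CexpMn zE.
have -> (x y : R) : lin_comb g h (a + x) (b + y) =
    lin_comb g h a b + lin_comb g h x y.
  by rewrite /lin_comb !rmorphD/=; ring.
congr (_ + _); elim: (nat_of_ord k) => [|i IH]; first by rewrite mulr1.
by rewrite iterS -zm -IH exprS; ring.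
Qed.

End LatticeTiling.

(** * Fourth, sixth and cube roots of unity *)

Section RootsOfUnity.
Variable R : realType.
Local Notation C := R[i].

Lemma two_pi_i_div (n : nat) :
  two_pi_i / n%:R = (0 +i* (pi *+ 2 / n%:R))%C :> C.
Proof.
rewrite two_pi_iE -(rmorph_nat (real_complex R)) -fmorphV /real_complex_def.
by simpc.
Qed.

Lemma Cexp_quarter : Cexp (two_pi_i / 4) = 'i%C :> C.
Proof.
rewrite two_pi_i_div CexpE expR0 !mul1r.
have -> : pi *+ 2 / 4 = pi / 2 :> R by field.
by rewrite cos_pihalf sin_pihalf.
Qed.

Lemma Cexp_sixth_expr2 : Cexp (two_pi_i / 6) ^+ 2 = omega :> C.
Proof. by rewrite -CexpMn /omega; congr Cexp; field. Qed.

Let pi3 : 0 < (pi *+ 2 / 6 : R) < pi / 2.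
Proof. by have := pi_gt0 R; lra. Qed.

Lemma Im_Cexp_sixth : 0 < Im (Cexp (two_pi_i / 6) : C).
Proof. by rewrite two_pi_i_div CexpE expR0 !mul1r/= sin_gt0_pihalf. Qed.

(** Here [z ^ 3 = -1] and [z] is not [-1], so [z + 1] cancels in
    [z ^ 3 + 1 = (z + 1) (z ^ 2 - z + 1)], leaving [z = 1 + z ^ 2]. *)
Lemma Cexp_sixth : Cexp (two_pi_i / 6) = 1 + omega :> C.
Proof.
rewrite -Cexp_sixth_expr2; set z := Cexp _.
have z3 : z ^+ 3 = -1.
  rewrite -CexpMn.
  have -> : two_pi_i / 6 *+ 3 = two_pi_i / 2 :> C by field.
  rewrite two_pi_i_div CexpE expR0 !mul1r.
  have -> : pi *+ 2 / 2 = pi :> R by field.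
  by rewrite cospi sinpi; apply/eqP; rewrite eq_complex/= oppr0 !eqxx.
have z1 : z + 1 != 0.
  apply: contraTneq Im_Cexp_sixth => z1; rewrite -[Cexp _]/z.
  by rewrite -(addrK 1 z) z1 sub0r /= oppr0 ltxx.
apply/eqP; rewrite eq_sym -subr_eq0 -(mulrI_eq0 _ (mulfI z1)).
by apply/eqP; rewrite -(subrr (-1)) -[X in _ = X - _]z3; ring.
Qed.

Lemma omegaE : omega = Cexp (two_pi_i / 6) - 1 :> C.
Proof. by rewrite Cexp_sixth addrAC subrr add0r. Qed.

Lemma omega_expr2 : omega ^+ 2 = - 1 - omega :> C.
Proof.
have := Cexp_sixth_expr2; rewrite Cexp_sixth => w2.
have -> : omega ^+ 2 = (1 + omega) ^+ 2 - 1 - omega *+ 2 :> C by ring.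
by rewrite w2; ring.
Qed.

Lemma Im_omega : 0 < Im (omega : C).
Proof. by rewrite omegaE ImB /= subr0 Im_Cexp_sixth. Qed.

(** The imaginary part of [omega ^ 2 = - 1 - omega] reads [2 a b = - b], and [b > 0] cancels. *)
Lemma Re_omega : Re (omega : C) = - 2^-1.
Proof.
have := omega_expr2; have := Im_omega.
case: omega => a b /= b0 /eqP; rewrite expr2 eq_complex/= => /andP[_ /eqP].
rewrite oppr0 sub0r => ab; apply: (mulfI (lt0r_neq0 b0)); lra.
Qed.

Lemma Im_omega_expr2 : Im (omega : C) ^+ 2 = 3 / 4.
Proof.
have := omega_expr2; have := Re_omega.
case: omega => a b /= -> /eqP; rewrite expr2 eq_complex/= => /andP[/eqP + _].
lra.
Qed.

End RootsOfUnity.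

(** * The tiling by squares *)

Section SquareTiling.
Variable R : realType.
Local Notation C := R[i].

Let det0 : basis_det (1 : C) 'i%C != 0.
Proof. by rewrite /basis_det/= mulr0 subr0 mul1r oner_eq0. Qed.

Definition square_ineqs : seq (R * R * R) :=
  [:: (1, 0, 1 / 2); (-1, 0, 1 / 2); (0, 1, 1 / 2); (0, -1, 1 / 2)].

Lemma square_hull (a b : R) :
  regular_polygon 4 (lin_comb 1 'i%C a b) ((1 + 'i%C) / 2) =
  polygon 1 'i%C a b square_ineqs.
Proof.
have -> : (1 + 'i%C) / 2 = lin_comb 1 'i%C (1 / 2) (1 / 2) :> C.
  by rewrite /lin_comb !fmorph_div rmorph1 !rmorph_nat; field.
rewrite (@regular_polygon_lin_comb _ _ _ 4 'i%C (fun x y => (- y, x)));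
  last 2 first.
- exact: Cexp_quarter.
- move=> x y; rewrite !lin_combE; simpc.
  by congr (_ +i* _)%C; rewrite /=; ring.
apply: (@convex_hull_polygon _ _ _ det0 _ _
  (fun k => iter k (fun p => (- p.2, p.1)) (1 / 2, 1 / 2))).
- by [].
- by case=> -[|[|[|[|]]]] //= _; rewrite /sat/=; apply/and5P; split=> //; lra.
- move=> x y; rewrite /sat/= => /and5P[x1 x2 y1 y2 _].
  (* Bilinear interpolation between the four corners, in counterclockwise order from
     [(1 / 2, 1 / 2)]. *)
  exists [:: (1 / 2 + x) * (1 / 2 + y); (1 / 2 - x) * (1 / 2 + y);
    (1 / 2 - x) * (1 / 2 - y); (1 / 2 + x) * (1 / 2 - y)].
  split; [|by rewrite !big_ord_recl big_ord0/=; field..].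
  by case=> -[|[|[|[|]]]] //= _; apply: mulr_ge0; lra.
Qed.

Lemma square_tilingE :
  square_tiling = lattice_polygons 1 'i%C (fun _ : unit => square_ineqs).
Proof.
have E (a b : int) :
    (a%:~R + b%:~R * 'i%C : C) = lin_comb 1 'i%C a%:~R b%:~R.
  by rewrite /lin_comb !rmorph_int mulr1.
apply/seteqP; split=> [_ [? [a [b ->]] <-]|_ [[[a b] []] _ <-]].
  by exists ((a, b), tt) => //=; rewrite E square_hull.
exists (a%:~R + b%:~R * 'i%C); first by exists a, b.
by rewrite E square_hull.
Qed.

Lemma tiling_square : tiling setT (@square_tiling R).
Proof.
rewrite square_tilingE; apply: tiling_lattice_polygons => //.
- by move=> _; rewrite /= !xpair_eqE !oppr_eq0 !oner_eq0 !andbF.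
- move=> _ x y; rewrite /sat/= => /and5P[x1 x2 y1 y2 _].
  by rewrite !ler_norml; split; apply/andP; split; lra.
- by move=> _; exists 0, 0; rewrite /strict_sat/=; apply/and5P; split=> //; lra.
(* Each coordinate is rounded to a nearest integer. *)
- move=> x y; exists (Num.floor (x + 1 / 2)), (Num.floor (y + 1 / 2)), tt.
  have := Num.Theory.floor_le (x + 1 / 2).
  have := Num.Theory.lt_succ_floor (x + 1 / 2).
  have := Num.Theory.floor_le (y + 1 / 2).
  have := Num.Theory.lt_succ_floor (y + 1 / 2).
  rewrite !intrD1 /sat/= => *; apply/and5P; split=> //; lra.
- move=> x y a b a' b' [] []; rewrite /strict_sat/=.
  move=> /and5P[x1 x2 y1 y2 _] /and5P[x1' x2' y1' y2' _].
  (* A common strict solution puts the centers less than 1 apart in each coordinate, and integers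
     that close are equal. *)
  have a1 : a < a' + 1 by rewrite -(ltr_int R) intrD1; lra.
  have a2 : a' < a + 1 by rewrite -(ltr_int R) intrD1; lra.
  have b1 : b < b' + 1 by rewrite -(ltr_int R) intrD1; lra.
  have b2 : b' < b + 1 by rewrite -(ltr_int R) intrD1; lra.
  by have -> : a = a' by [lia]; have -> : b = b' by [lia].
Qed.

End SquareTiling.

(** * The tiling by hexagons *)

Section HexagonalTiling.
Variable R : realType.
Local Notation C := R[i].

Let det0 : basis_det (1 : C) omega != 0.
Proof.
by rewrite /basis_det [Re 1]/= [Im 1]/= mul0r subr0 mul1r lt0r_neq0// Im_omega.
Qed.

(** The Voronoi cell of 0 in [Z[omega]]: as [|x + y omega| ^ 2 = x ^ 2 - x y + y ^ 2], each
    inequality says that 0 is at least as near as one of its six neighbours. *)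
Definition hexagon_ineqs : seq (R * R * R) :=
  [:: (2, -1, 1); (-2, 1, 1); (-1, 2, 1); (1, -2, 1); (1, 1, 1); (-1, -1, 1)].

Lemma hexagon_hull (a b : R) :
  regular_polygon 6 (lin_comb 1 omega a b) ((2 + omega) / 3) =
  polygon 1 omega a b hexagon_ineqs.
Proof.
have -> : (2 + omega) / 3 = lin_comb 1 omega (2 / 3) (1 / 3) :> C.
  by rewrite /lin_comb !fmorph_div rmorph1 !rmorph_nat; field.
(* Rotation by a sixth of a turn: [(1 + omega) (x + y omega) = (x - y) + x omega]. *)
rewrite (@regular_polygon_lin_comb _ _ _ 6 (1 + omega) (fun x y => (x - y, x)));
  last 2 first.
- exact: Cexp_sixth.
- move=> x y; rewrite /lin_comb rmorphB/=.
  by have := omega_expr2 R => w2; ring: w2.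
pose vertex k : R * R := iter k (fun p => (p.1 - p.2, p.1)) (2 / 3, 1 / 3).
apply: (@convex_hull_polygon _ _ _ det0 _ _ vertex).
- by [].
- case=> -[|[|[|[|[|[|]]]]]] //= _; rewrite /sat/=;
  by do !(apply/andP; split=> //); lra.
- move=> x y; rewrite /sat/= => /and5P[p1 p2 q1 q2 /and3P[r1 r2 _]].
  (* The center is the mean of the vertices, and takes the remaining weight. *)
  have weights (c0 c1 c2 c3 c4 c5 : R) :
      0 <= c0 -> 0 <= c1 -> 0 <= c2 -> 0 <= c3 -> 0 <= c4 -> 0 <= c5 ->
      c0 + c1 + c2 + c3 + c4 + c5 <= 1 ->
      x = (2 * c0 + c1 - c2 - 2 * c3 - c4 + c5) / 3 ->
      y = (c0 + 2 * c1 + c2 - c3 - 2 * c4 - c5) / 3 ->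
      let d := (1 - (c0 + c1 + c2 + c3 + c4 + c5)) / 6 in
      exists t : seq R, [/\ forall k : 'I_6, 0 <= t`_k, \sum_(k < 6) t`_k = 1,
        x = \sum_(k < 6) t`_k * (vertex k).1
      & y = \sum_(k < 6) t`_k * (vertex k).2].
    move=> c0p c1p c2p c3p c4p c5p cs -> -> d.
    exists [:: c0 + d; c1 + d; c2 + d; c3 + d; c4 + d; c5 + d].
    have d0 : 0 <= d by rewrite /d; lra.
    split; [|by rewrite !big_ord_recl big_ord0/= /d; field..].
    by case=> -[|[|[|[|[|[|]]]]]] //= _; lra.
  (* The six sectors between consecutive vertices. *)
  have [p0|p0] := leP 0 (2 * x - y); have [q0|q0] := leP 0 (2 * y - x).
  + by apply: (weights (2 * x - y) (2 * y - x) 0 0 0 0) => //; lra.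
  + have [r0|r0] := leP 0 (x + y).
    * by apply: (weights (x + y) 0 0 0 0 (x - 2 * y)) => //; lra.
    * by apply: (weights 0 0 0 0 (- x - y) (2 * x - y)) => //; lra.
  + have [r0|r0] := leP 0 (x + y).
    * by apply: (weights 0 (x + y) (y - 2 * x) 0 0 0) => //; lra.
    * by apply: (weights 0 0 (2 * y - x) (- x - y) 0 0) => //; lra.
  + by apply: (weights 0 0 0 (y - 2 * x) (x - 2 * y) 0) => //; lra.
Qed.

Lemma hexagonal_tilingE :
  hexagonal_tiling = lattice_polygons 1 omega (fun _ : unit => hexagon_ineqs).
Proof.
have E (a b : int) :
    (a%:~R + b%:~R * omega : C) = lin_comb 1 omega a%:~R b%:~R.
  by rewrite /lin_comb !rmorph_int mulr1.
apply/seteqP; split=> [_ [? [a [b ->]] <-]|_ [[[a b] []] _ <-]].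
  by exists ((a, b), tt) => //=; rewrite E hexagon_hull.
exists (a%:~R + b%:~R * omega); first by exists a, b.
by rewrite E hexagon_hull.
Qed.

(** For the differences [u], [v] of the centers, [2 u - v], [2 v - u] and [u + v] are integers of
    modulus at most 1. Adding the third to the others bounds [3 u] and [3 v] by 2, so both
    vanish. *)
Lemma hexagon_center_inj (a b a' b' : int) :
  2 * a - b < 2 * a' - b' + 2 -> 2 * a' - b' < 2 * a - b + 2 ->
  2 * b - a < 2 * b' - a' + 2 -> 2 * b' - a' < 2 * b - a + 2 ->
  a + b < a' + b' + 2 -> a' + b' < a + b + 2 -> a = a' /\ b = b'.
Proof. lia. Qed.

Lemma tiling_hexagonal : tiling setT (@hexagonal_tiling R).
Proof.
rewrite hexagonal_tilingE; apply: tiling_lattice_polygons => //.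
- by move=> _; rewrite /= !xpair_eqE !oppr_eq0 !oner_eq0 !pnatr_eq0 !andbF.
- move=> _ x y; rewrite /sat/= => /and5P[p1 p2 q1 q2 /and3P[r1 r2 _]].
  by rewrite !ler_norml; split; apply/andP; split; lra.
- move=> _; exists 0, 0; rewrite /strict_sat/=.
  by do !(apply/andP; split=> //); lra.
- move=> x y; set a := Num.floor x; set b := Num.floor y.
  have := Num.Theory.floor_le x; have := Num.Theory.lt_succ_floor x.
  have := Num.Theory.floor_le y; have := Num.Theory.lt_succ_floor y.
  rewrite -/a -/b !intrD1 => by1 by0 ax1 ax0.
  (* One of the four corners of the floor cell is the center sought; each test compares the
     distances to two of these corners. *)
  have [s|s] := leP (x - a%:~R + (y - b%:~R)) 1.
    have [p|p] := leP (2 * (x - a%:~R) - (y - b%:~R)) 1; last first.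
      exists (a + 1), b, tt; rewrite /sat/= intrD1.
      by do !(apply/andP; split=> //); lra.
    have [q|q] := leP (2 * (y - b%:~R) - (x - a%:~R)) 1.
      by exists a, b, tt; rewrite /sat/=; do !(apply/andP; split=> //); lra.
    exists a, (b + 1), tt; rewrite /sat/= intrD1.
    by do !(apply/andP; split=> //); lra.
  have [p|p] := leP 0 (2 * (y - b%:~R) - (x - a%:~R)); last first.
    exists (a + 1), b, tt; rewrite /sat/= intrD1.
    by do !(apply/andP; split=> //); lra.
  have [q|q] := leP 0 (2 * (x - a%:~R) - (y - b%:~R)).
    exists (a + 1), (b + 1), tt; rewrite /sat/= !intrD1.
    by do !(apply/andP; split=> //); lra.
  exists a, (b + 1), tt; rewrite /sat/= intrD1.
  by do !(apply/andP; split=> //); lra.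
- move=> x y a b a' b' [] []; rewrite /strict_sat/=.
  move=> /and5P[p1 p2 q1 q2 /and3P[r1 r2 _]].
  move=> /and5P[p1' p2' q1' q2' /and3P[r1' r2' _]].
  (* Each bound adds an inequality of one hexagon to the opposite inequality of the other. *)
  have P1 : 2 * a - b < 2 * a' - b' + 2.
    by rewrite -(ltr_int R) !(rmorphD, rmorphN, rmorphM)/=; lra.
  have P2 : 2 * a' - b' < 2 * a - b + 2.
    by rewrite -(ltr_int R) !(rmorphD, rmorphN, rmorphM)/=; lra.
  have Q1 : 2 * b - a < 2 * b' - a' + 2.
    by rewrite -(ltr_int R) !(rmorphD, rmorphN, rmorphM)/=; lra.
  have Q2 : 2 * b' - a' < 2 * b - a + 2.
    by rewrite -(ltr_int R) !(rmorphD, rmorphN, rmorphM)/=; lra.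
  have S1 : a + b < a' + b' + 2.
    by rewrite -(ltr_int R) !(rmorphD, rmorphN, rmorphM)/=; lra.
  have S2 : a' + b' < a + b + 2.
    by rewrite -(ltr_int R) !(rmorphD, rmorphN, rmorphM)/=; lra.
  by have [-> ->] := hexagon_center_inj P1 P2 Q1 Q2 S1 S2.
Qed.

End HexagonalTiling.

(** * Units of the Eisenstein integers and the tiling by triangles *)

(** The form is [|A + B omega| ^ 2], and the list is the six units of [Z[omega]]. Four times the
    form is [(2 B - A) ^ 2 + 3 A ^ 2], so [A ^ 2 <= 1], and likewise for [B]; nine cases remain. *)
Lemma eisenstein_units (A B : int) : A * A - A * B + B * B = 1 ->
  (A, B) \in [:: (1, 0); (1, 1); (0, 1); (-1, 0); (-1, -1); (0, -1)].
Proof.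
have sq1 (x : int) : x * x <= 1 -> x <= 1 /\ -1 <= x by move=> ?; split; nia.
move=> AB; have A4 := sqr_ge0 (2 * B - A); have B4 := sqr_ge0 (2 * A - B).
have {}A4 : A * A <= 1 by rewrite expr2 in A4; nia.
have {}B4 : B * B <= 1 by rewrite expr2 in B4; nia.
have [A1 A2] := sq1 _ A4.
have [B1 B2] := sq1 _ B4.
have AE : A = -1 \/ A = 0 \/ A = 1 by lia.
have BE : B = -1 \/ B = 0 \/ B = 1 by lia.
by move: AB; case: AE => [->|[->|->]]; case: BE => [->|[->|->]].
Qed.

Section TriangularTiling.
Variable R : realType.
Local Notation C := R[i].
Local Notation g := (2 + omega : C).
Local Notation h := ((2 + omega) * omega : C).

Lemma Re_two_omega : Re g = 3 / 2.
Proof. by have := Re_omega R; case: omega => ? ? /= ->; lra. Qed.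

Lemma Im_two_omega : Im g = Im (omega : C).
Proof. by case: omega => ? ? /=; lra. Qed.

Lemma two_omega_omega : h = omega - 1.
Proof. by rewrite mulrDl -expr2 omega_expr2; ring. Qed.

Lemma Re_two_omega_omega : Re h = - (3 / 2).
Proof.
by rewrite two_omega_omega; have := Re_omega R; case: omega => ? ? /= ->; lra.
Qed.

Lemma Im_two_omega_omega : Im h = Im (omega : C).
Proof. by rewrite two_omega_omega; case: omega => ? ? /=; lra. Qed.

Let det0 : basis_det g h != 0.
Proof.
rewrite /basis_det Re_two_omega Im_two_omega.
rewrite Re_two_omega_omega Im_two_omega_omega.
by apply: lt0r_neq0; have := Im_omega R; lra.
Qed.

(** As [|2 + omega| ^ 2 = 3], the squared modulus is [3 (A ^ 2 - A B + B ^ 2)]: side vectors of the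
    triangles correspond to units. *)
Lemma dist_lin_comb (A B : int) :
  `|lin_comb g h A%:~R B%:~R| = (Num.sqrt 3)%:C%C <->
  A * A - A * B + B * B = 1.
Proof.
have normE (x y : R) : `|(x +i* y)%C| = (Num.sqrt (x ^+ 2 + y ^+ 2))%:C%C.
  exact: normc_def.
rewrite lin_combE normE.
rewrite Re_two_omega Im_two_omega Re_two_omega_omega Im_two_omega_omega.
set s := Num.sqrt _.
have -> : s = Num.sqrt (3 * (A * A - A * B + B * B)%:~R).
  rewrite /s; congr Num.sqrt; rewrite !(rmorphD, rmorphN, rmorphM)/=.
  by rewrite -mulrDl exprMn Im_omega_expr2; field.
have N0 : 0 <= A * A - A * B + B * B by nia.
split=> [/complexI/eqP|->]; last by rewrite mulr1.
rewrite eqr_sqrt ?mulr_ge0 ?ler0z// => /eqP E.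
apply/eqP; rewrite -(eqr_int R); apply/eqP; lra.
Qed.

(** The diagonal [x = y], of length [sqrt 3], cuts the coordinate cell into two triangles; [up]
    selects the half [y <= x]. *)
Definition triangle_ineqs (up : bool) : seq (R * R * R) :=
  if up then [:: (0, -1, 0); (1, 0, 1); (-1, 1, 0)]
  else [:: (-1, 0, 0); (0, 1, 1); (1, -1, 0)].

Definition triangle_vertex (A1 A2 B1 B2 : int) (k : nat) : int * int :=
  nth (0, 0) [:: (0, 0); (A1, A2); (B1, B2)] k.

(* The triangle with vertices [(0, 0)], [(A1, A2)], [(B1, B2)] is the half of
   the unit cell with lower left corner [(a, b)] selected by [up]; the last
   condition bounds the barycentric coordinates. *)
Definition triangle_type (A1 A2 B1 B2 a b : int) (up : bool) : Prop :=
  let d : R := (A1 * B2 - A2 * B1)%:~R in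
  [/\ d * d = 1,
   forall k : 'I_3, let p := triangle_vertex A1 A2 B1 B2 k in
     sat (triangle_ineqs up) (p.1%:~R - a%:~R) (p.2%:~R - b%:~R)
   & forall x y, sat (triangle_ineqs up) (x - a%:~R) (y - b%:~R) ->
     [/\ 0 <= d * (x * B2%:~R - y * B1%:~R), 0 <= d * (y * A1%:~R - x * A2%:~R)
      & d * (x * B2%:~R - y * B1%:~R) + d * (y * A1%:~R - x * A2%:~R) <= 1]].

(** The determinant [d] is 1 or -1, so multiplying by [d] is dividing by it: [s] and [t] are the
    solutions of Cramer's rule, and [1 - s - t], [s], [t] are the barycentric weights. *)
Lemma triangle_hull (p q A1 A2 B1 B2 a b : int) (up : bool) :
  triangle_type A1 A2 B1 B2 a b up ->
  convex_hull (fun k : 'I_3 => let u := triangle_vertex A1 A2 B1 B2 k in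
    lin_comb g h (p + u.1)%:~R (q + u.2)%:~R) =
  polygon g h (p + a)%:~R (q + b)%:~R (triangle_ineqs up).
Proof.
move=> [dd V H].
apply: (@convex_hull_polygon _ _ _ det0 _ _
  (fun k => let u := triangle_vertex A1 A2 B1 B2 k in
    (u.1%:~R - a%:~R, u.2%:~R - b%:~R))).
- by move=> k /=; rewrite !rmorphD/=; congr lin_comb; ring.
- exact: V.
- move=> x y xy; have := H (x + a%:~R) (y + b%:~R).
  rewrite !addrK => /(_ xy)[]; rewrite !(rmorphD, rmorphN, rmorphM)/= in dd *.
  set d := _ - _ in dd *; set s := d * _; set t := d * _ => s0 t0 st.
  exists [:: 1 - s - t; s; t]; split.
  + by case=> -[|[|[|]]] //= _; lra.
  + by rewrite !big_ord_recl big_ord0/=; ring.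
  + rewrite !big_ord_recl big_ord0/=.
    suff : s * A1%:~R + t * B1%:~R = (x + a%:~R) * (d * d) by rewrite dd; lra.
    by rewrite /s /t /d; ring.
  + rewrite !big_ord_recl big_ord0/=.
    suff : s * A2%:~R + t * B2%:~R = (y + b%:~R) * (d * d) by rewrite dd; lra.
    by rewrite /s /t /d; ring.
Qed.

(** Both edge vectors are units, and so is their difference; this leaves 12 of the 36 pairs, each
    with its explicit half cell. *)
Lemma triangle_typeP (A1 A2 B1 B2 : int) :
  A1 * A1 - A1 * A2 + A2 * A2 = 1 -> B1 * B1 - B1 * B2 + B2 * B2 = 1 ->
  (A1 - B1) * (A1 - B1) - (A1 - B1) * (A2 - B2) + (A2 - B2) * (A2 - B2) = 1 ->
  exists a b up, triangle_type A1 A2 B1 B2 a b up.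
Proof.
move=> /eisenstein_units + /eisenstein_units; rewrite !inE !xpair_eqE.
do 5?[case/orP]; move=> /andP[/eqP-> /eqP->];
  do 5?[case/orP]; move=> /andP[/eqP-> /eqP->] => // _;
  [ exists 0, 0, true | exists 0, (-1), false
      | exists 0, 0, true | exists 0, 0, false
      | exists 0, 0, false | exists (-1), 0, true
      | exists (-1), 0, true | exists (-1), (-1), false
      | exists (-1), (-1), false | exists (-1), (-1), true
      | exists 0, (-1), false | exists (-1), (-1), true ];
  (split; [lra
  | case=> -[|[|[|]]] //= _; rewrite /sat/=; apply/and4P; split=> //; lra
  | move=> x y; rewrite /sat/= => /and4P[*]; split; lra]).
Qed.

Lemma P0E (z : C) : P0 z <-> exists p q : int, z = lin_comb g h p%:~R q%:~R.
Proof.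
have E (p q : int) :
    (2 + omega) * (p%:~R + q%:~R * omega) = lin_comb g h p%:~R q%:~R.
  by rewrite /lin_comb !rmorph_int; ring.
split=> [[_ [p [q ->]] <-]|[p [q ->]]]; first by exists p, q; rewrite E.
by exists (p%:~R + q%:~R * omega) => //; exists p, q.
Qed.

Lemma lin_combB (x y x' y' : R) :
  lin_comb g h x y - lin_comb g h x' y' = lin_comb g h (x - x') (y - y').
Proof. by rewrite /lin_comb !rmorphB/=; ring. Qed.

(** A triangle is first moved so that one vertex is the origin, which reduces it to
    [triangle_typeP]. *)
Lemma triangular_tilingE :
  triangular_tiling = lattice_polygons g h triangle_ineqs.
Proof.
apply/seteqP; split=> [_ [v [vP0 vd ->]]|_ [[[p q] up] _ <-]].
  pose k0 : 'I_3 := ord0; pose k1 : 'I_3 := inord 1; pose k2 : 'I_3 := inord 2.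
  have [p0 [q0 v0]] := (P0E _).1 (vP0 k0).
  have [p1 [q1 v1]] := (P0E _).1 (vP0 k1).
  have [p2 [q2 v2]] := (P0E _).1 (vP0 k2).
  have [k10 k20 k12] : [/\ k1 != k0, k2 != k0 & k1 != k2].
    by rewrite -!val_eqE /= !inordK.
  have d10 := vd _ _ k10; have d20 := vd _ _ k20; have d12 := vd _ _ k12.
  rewrite v1 v0 lin_combB -!rmorphB dist_lin_comb in d10.
  rewrite v2 v0 lin_combB -!rmorphB dist_lin_comb in d20.
  rewrite v1 v2 lin_combB -!rmorphB dist_lin_comb in d12.
  have [//|//||a [b [up ok]]] :=
    @triangle_typeP (p1 - p0) (q1 - q0) (p2 - p0) (q2 - q0).
    by rewrite !opprB !addrA !subrK.
  exists (p0 + a, q0 + b, up) => //=; rewrite -(triangle_hull _ _ ok).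
  congr convex_hull; apply/funext => k.
  have : k = k0 \/ k = k1 \/ k = k2.
    case: k => -[|[|[|]]]// k3; [left|right; left|right; right];
    by apply: val_inj; rewrite /= ?inordK.
  case=> [->|[->|->]];
  by rewrite ?v0 ?v1 ?v2 /= ?inordK//= ?addr0 ?addrNK ?subrKC.
(* Conversely, each half cell has vertices [(0, 0)], [(1, 1)] and either [(1, 0)] or [(0, 1)]. *)
have [A1 [A2 [B1 [B2 [dA dB dAB ok]]]]] : exists A1 A2 B1 B2 : int,
   [/\ A1 * A1 - A1 * A2 + A2 * A2 = 1, B1 * B1 - B1 * B2 + B2 * B2 = 1,
    (A1 - B1) * (A1 - B1) - (A1 - B1) * (A2 - B2) + (A2 - B2) * (A2 - B2) = 1
    & triangle_type A1 A2 B1 B2 0 0 up].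
  case: up; [exists 1, 0, 1, 1|exists 0, 1, 1, 1]; split=> //;
  (split; [lra
   | case=> -[|[|[|]]] //= _; rewrite /sat/=; apply/and4P; split=> //; lra
   | move=> x y; rewrite /sat/= => /and4P[*]; split; lra]).
have /= := triangle_hull p q ok; rewrite !addr0 => <-.
eexists; split; last reflexivity.
  by move=> k; apply/P0E; eexists; eexists; reflexivity.
move=> j k jk; rewrite lin_combB -!rmorphB dist_lin_comb/=.
by case: j k jk => -[|[|[|]]]// j3 [[|[|[|]]]// k3] //= _; lia.
Qed.

Lemma tiling_triangular : tiling setT (@triangular_tiling R).
Proof.
rewrite triangular_tilingE; apply: tiling_lattice_polygons => //.
- by case; rewrite /= !xpair_eqE !oppr_eq0 !oner_eq0 ?andbF.
- case=> x y; rewrite /sat/= => /and4P[p1 p2 p3 _];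
  by rewrite !ler_norml; split; apply/andP; split; lra.
- case; [exists (2 / 3), (1 / 3)|exists (1 / 3), (2 / 3)];
  by rewrite /strict_sat/=; apply/and4P; split=> //; lra.
- move=> x y; exists (Num.floor x), (Num.floor y).
  have := Num.Theory.floor_le x; have := Num.Theory.lt_succ_floor x.
  have := Num.Theory.floor_le y; have := Num.Theory.lt_succ_floor y.
  rewrite !intrD1 => by1 by0 ax1 ax0.
  (* Within the floor cell, the side of the diagonal decides the triangle. *)
  have [xy|xy] := leP (y - (Num.floor y)%:~R) (x - (Num.floor x)%:~R).
    by exists true; rewrite /sat/=; apply/and4P; split=> //; lra.
  by exists false; rewrite /sat/=; apply/and4P; split=> //; lra.
- move=> x y a b a' b' j j' xy xy'.
  (* A strict solution lies inside the open cell, which determines [a] and [b], and off the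
     diagonal, which determines the half. *)
  have bnd k (c d : R) : strict_sat (triangle_ineqs k) c d ->
      [/\ 0 < c, c < 1, 0 < d, d < 1 & (k = true <-> d < c)].
    case: k; rewrite /strict_sat/= => /and4P[*];
    by split; try lra; split=> //; lra.
  have {xy}[x1 x2 y1 y2 xy] := bnd _ _ _ xy.
  have {xy'}[x1' x2' y1' y2' xy'] := bnd _ _ _ xy'.
  have a1 : a < a' + 1 by rewrite -(ltr_int R) intrD1; lra.
  have a2 : a' < a + 1 by rewrite -(ltr_int R) intrD1; lra.
  have b1 : b < b' + 1 by rewrite -(ltr_int R) intrD1; lra.
  have b2 : b' < b + 1 by rewrite -(ltr_int R) intrD1; lra.
  have aa : a = a' by apply/eqP; rewrite eq_le -!ltzD1 a1 a2.
  have bb : b = b' by apply/eqP; rewrite eq_le -!ltzD1 b1 b2.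
  rewrite -aa -bb in xy' *; congr (_, _, _); apply/idP/idP.
    by move=> /xy/xy'.
  by move=> /xy'/xy.
Qed.

End TriangularTiling.

(** * Images of the three regular tilings in the punctured plane *)

Unset Implicit Arguments.

Theorem theorem3 (R : realType) (S : set (set R[i])) (alpha m : R[i])
    (hS : S = square_tiling \/ S = hexagonal_tiling \/ S = triangular_tiling)
    (alpha_neq0 : alpha != 0)
    (alpha_orbit : orbit_of_origin S alpha)
    (m_max : is_max (boundary_distances S) m)
    (alpha_gt : m < `|alpha|) :
  tiling punctured_plane [set varphi alpha @` T | T in S].
Proof.
have tS : tiling setT S.
  by case: hS => [->|[->|->]];
    [exact: tiling_square|exact: tiling_hexagonal|exact: tiling_triangular].
(* The translation by [v] sends 0 to [alpha], so [v = alpha] and translation by [alpha] preserves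
   [S]. *)
case: alpha_orbit => f [[v ->] vS]; rewrite /translation add0r => vE.
by apply: tiling_varphi => //; rewrite -vE.
Qed.
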